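(* Let $X$ be a real Banach space, $f\in\Gamma_0(X)$ and $f(\bar x)=0$. Then $$|\partial f|_{\rm bd}(\bar x)=\inf\{\varepsilon>0\mid \mathrm{Er}\{\mathrm{Ptb}(f,\bar x,\varepsilon)\}(\bar x)=0\}=\inf\{\varepsilon>0\mid \mathrm{Er}\{\mathrm{Ptb}_c(f,\bar x,\varepsilon)\}(\bar x)=0\}=\inf\{\varepsilon>0\mid \mathrm{Er}\{\mathrm{Ptb}_l(f,\bar x,\varepsilon)\}(\bar x)=0\}.$$
   Context: $X^*$ is the dual of $X$, $\mathbb{B}^*$ its closed unit ball. $\Gamma_0(X)$ denotes the class of extended-real-valued proper convex lower semicontinuous functions on $X$. For convex $f$ and $x\in\mathrm{dom} f$, $\partial f(x):=\{x^*\in X^*\mid \langle x^*,u-x\rangle\le f(u)-f(x)\ \forall u\in X\}$. $d(x,S)=\inf_{u\in S}\|u-x\|$ with $d(x,\emptyset)=+\infty$; $\inf\emptyset=+\infty$. $S_f:=\{x\in X\mid f(x)\le0\}$. The local error bound modulus is $\mathrm{Er}\,f(\bar x):=\liminf_{x\to\bar x,\ f(x)>0}\frac{f(x)}{d(x,S_f)}$. The boundary subdifferential slope is $|\partial f|_{\rm bd}(\bar x):=d(0,\mathrm{bd}\,\partial f(\bar x))$ (boundary in the norm topology of $X^*$). For $f(\bar x)<\infty$ and $\varepsilon\ge0$: $g:X\to\mathbb{R}\cup\{+\infty\}$ is an $\varepsilon$-perturbation of $f$ near $\bar x$ if $g(\bar x)=f(\bar x)$ and $\limsup_{x\to\bar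 x}\frac{|g(x)-f(x)|}{\|x-\bar x\|}\le\varepsilon$; the set of these is $\mathrm{Ptb}(f,\bar x,\varepsilon)$. $\mathrm{Ptb}_c(f,\bar x,\varepsilon):=\{g\in\mathrm{Ptb}(f,\bar x,\varepsilon)\mid g-f\in\Gamma_0(X)\}$, and $\mathrm{Ptb}_l(f,\bar x,\varepsilon):=\{g\mid g(u)-f(u)=\langle x^*,u-\bar x\rangle\ (u\in X)\text{ for some }x^*\in\varepsilon\mathbb{B}^*\}$. Further, $\mathrm{Er}\{\mathrm{Ptb}(f,\bar x,\varepsilon)\}(\bar x):=\inf_{g\in\Gamma_0(X)\cap\mathrm{Ptb}(f,\bar x,\varepsilon)}\mathrm{Er}\,g(\bar x)$, $\mathrm{Er}\{\mathrm{Ptb}_c(f,\bar x,\varepsilon)\}(\bar x):=\inf_{g\in\mathrm{Ptb}_c(f,\bar x,\varepsilon)}\mathrm{Er}\,g(\bar x)$, $\mathrm{Er}\{\mathrm{Ptb}_l(f,\bar x,\varepsilon)\}(\bar x):=\inf_{g\in\mathrm{Ptb}_l(f,\bar x,\varepsilon)}\mathrm{Er}\,g(\bar x)$. *)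

(* Defs.v *)
From Stdlib Require Import Reals Lra Classical ClassicalEpsilon.
Open Scope R_scope.
Set Implicit Arguments.

Inductive ERbar : Type := Fin (r : R) | PInf | MInf.

Definition ERle (a b : ERbar) : Prop :=
  match a, b with
  | MInf, _ => True
  | _, PInf => True
  | Fin x, Fin y => x <= y
  | _, _ => False
  end.

Definition ERlt (a b : ERbar) : Prop := ERle a b /\ a <> b.

(* addition; PInf absorbing (MInf never occurs for proper functions) *)
Definition ERplus (a b : ERbar) : ERbar :=
  match a, b with
  | Fin x, Fin y => Fin (x + y)
  | PInf, _ | _, PInf => PInf
  | _, _ => MInf
  end.

Definition is_glb (S : ERbar -> Prop) (m : ERbar) : Prop :=
  (forall y, S y -> ERle m y) /\ (forall m', (forall y, S y -> ERle m' y) -> ERle m' m).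
Definition is_lub (S : ERbar -> Prop) (m : ERbar) : Prop :=
  (forall y, S y -> ERle y m) /\ (forall m', (forall y, S y -> ERle y m') -> ERle m m').

(* infimum / supremum in the complete lattice of extended reals
   (inf of the empty set is +oo) *)
Definition ERinf (S : ERbar -> Prop) : ERbar := epsilon (inhabits PInf) (is_glb S).
Definition ERsup (S : ERbar -> Prop) : ERbar := epsilon (inhabits MInf) (is_lub S).

Record BanachSpace : Type := {
  carrier :> Type;
  vzero : carrier;
  vplus : carrier -> carrier -> carrier;
  vopp : carrier -> carrier;
  vscal : R -> carrier -> carrier;
  vnorm : carrier -> R;
  vplus_assoc : forall x y z, vplus x (vplus y z) = vplus (vplus x y) z;
  vplus_comm : forall x y, vplus x y = vplus y x;
  vplus_zero : forall x, vplus x vzero = x;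
  vplus_opp : forall x, vplus x (vopp x) = vzero;
  vscal_one : forall x, vscal 1 x = x;
  vscal_assoc : forall a b x, vscal a (vscal b x) = vscal (a * b) x;
  vscal_distr_l : forall a x y, vscal a (vplus x y) = vplus (vscal a x) (vscal a y);
  vscal_distr_r : forall a b x, vscal (a + b) x = vplus (vscal a x) (vscal b x);
  vnorm_nonneg : forall x, 0 <= vnorm x;
  vnorm_eq0 : forall x, vnorm x = 0 -> x = vzero;
  vnorm_scal : forall a x, vnorm (vscal a x) = Rabs a * vnorm x;
  vnorm_triangle : forall x y, vnorm (vplus x y) <= vnorm x + vnorm y;
  vcomplete : forall u : nat -> carrier,
    (forall e, 0 < e -> exists N, forall m n, (N <= m)%nat -> (N <= n)%nat ->
        vnorm (vplus (u m) (vopp (u n))) < e) ->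
    exists l, forall e, 0 < e -> exists N, forall n, (N <= n)%nat ->
        vnorm (vplus (u n) (vopp l)) < e
}.

Section Defs.
Context {X : BanachSpace}.

Definition vminus (x y : X) : X := vplus X x (vopp X y).
Definition nrm (x : X) : R := vnorm X x.

Definition proper (f : X -> ERbar) : Prop :=
  (forall x, f x <> MInf) /\ (exists x, f x <> PInf).

Definition convex (f : X -> ERbar) : Prop :=
  forall x y a b t, f x = Fin a -> f y = Fin b -> 0 <= t <= 1 ->
    ERle (f (vplus X (vscal X t x) (vscal X (1 - t) y))) (Fin (t * a + (1 - t) * b)).

Definition lsc (f : X -> ERbar) : Prop :=
  forall x r, ERlt (Fin r) (f x) ->
    exists d, 0 < d /\ forall u, nrm (vminus u x) < d -> ERlt (Fin r) (f u).

Definition Gamma0 (f : X -> ERbar) : Prop := proper f /\ convex f /\ lsc f.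

Definition is_dual (phi : X -> R) : Prop :=
  (forall x y, phi (vplus X x y) = phi x + phi y) /\
  (forall a x, phi (vscal X a x) = a * phi x) /\
  (exists M, forall x, Rabs (phi x) <= M * nrm x).

Definition dnorm (phi : X -> R) : ERbar :=
  ERsup (fun v => exists x, nrm x <= 1 /\ v = Fin (Rabs (phi x))).

Definition dminus (phi psi : X -> R) : X -> R := fun x => phi x - psi x.

Definition subdiff (f : X -> ERbar) (xb : X) (phi : X -> R) : Prop :=
  is_dual phi /\
  match f xb with
  | Fin c => forall u, ERle (Fin (phi (vminus u xb) + c)) (f u)
  | _ => False
  end.

Definition bd (S : (X -> R) -> Prop) (phi : X -> R) : Prop :=
  is_dual phi /\
  forall r, 0 < r ->
    (exists psi, is_dual psi /\ S psi /\ ERlt (dnorm (dminus psi phi)) (Fin r)) /\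
    (exists psi, is_dual psi /\ ~ S psi /\ ERlt (dnorm (dminus psi phi)) (Fin r)).

Definition bd_slope (f : X -> ERbar) (xb : X) : ERbar :=
  ERinf (fun v => exists phi, bd (subdiff f xb) phi /\ v = dnorm phi).

(* d(x,S) = inf_{u in S} ||u - x||, = +oo if S empty *)
Definition dist (x : X) (S : X -> Prop) : ERbar :=
  ERinf (fun v => exists u, S u /\ v = Fin (nrm (vminus u x))).

Definition Slev (f : X -> ERbar) : X -> Prop := fun x => ERle (f x) (Fin 0).

(* quotient f(x)/d(x,S_f); only the cases a in (0,+oo], d in (0,+oo) matter *)
Definition ratio (a b : ERbar) : ERbar :=
  match a, b with
  | Fin x, Fin y => if Rlt_dec 0 y then Fin (x / y) else PInf
  | PInf, Fin _ => PInf
  | Fin _, PInf => Fin 0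
  | PInf, PInf => Fin 0
  | MInf, _ => MInf
  | _, MInf => MInf
  end.

(* Er f(xb) = liminf_{x -> xb, f x > 0} f(x)/d(x,S_f)
           = sup_{delta>0} inf { f x / d(x,S_f) | ||x - xb|| < delta, f x > 0 } *)
Definition Er (f : X -> ERbar) (xb : X) : ERbar :=
  ERsup (fun s => exists delta, 0 < delta /\
    s = ERinf (fun w => exists x, nrm (vminus x xb) < delta /\ ERlt (Fin 0) (f x) /\
                                  w = ratio (f x) (dist x (Slev f)))).

(* |a - b| <= c, with the convention (+oo) - (+oo) = 0 *)
Definition absdiff_le (a b : ERbar) (c : R) : Prop :=
  match a, b with
  | Fin x, Fin y => Rabs (x - y) <= c
  | PInf, PInf => True
  | MInf, MInf => True
  | _, _ => False
  end.

(* g in Ptb(f,xb,eps): g xb = f xb and limsup_{x->xb} |g x - f x| / ||x - xb|| <= eps *)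
Definition Ptb (f : X -> ERbar) (xb : X) (eps : R) (g : X -> ERbar) : Prop :=
  g xb = f xb /\
  forall eta, 0 < eta -> exists delta, 0 < delta /\
    forall x, nrm (vminus x xb) < delta ->
      absdiff_le (g x) (f x) ((eps + eta) * nrm (vminus x xb)).

(* g - f in Gamma0(X), read as g = f + h with h in Gamma0(X) *)
Definition Ptb_c (f : X -> ERbar) (xb : X) (eps : R) (g : X -> ERbar) : Prop :=
  Ptb f xb eps g /\ exists h, Gamma0 h /\ forall u, g u = ERplus (f u) (h u).

(* g(u) - f(u) = <x*, u - xb>, x* in eps B^*, read as g = f + <x*, . - xb> *)
Definition Ptb_l (f : X -> ERbar) (xb : X) (eps : R) (g : X -> ERbar) : Prop :=
  exists phi, is_dual phi /\ ERle (dnorm phi) (Fin eps) /\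
    forall u, g u = ERplus (f u) (Fin (phi (vminus u xb))).

Definition ErPtb (f : X -> ERbar) (xb : X) (eps : R) : ERbar :=
  ERinf (fun v => exists g, Gamma0 g /\ Ptb f xb eps g /\ v = Er g xb).
Definition ErPtb_c (f : X -> ERbar) (xb : X) (eps : R) : ERbar :=
  ERinf (fun v => exists g, Ptb_c f xb eps g /\ v = Er g xb).
Definition ErPtb_l (f : X -> ERbar) (xb : X) (eps : R) : ERbar :=
  ERinf (fun v => exists g, Ptb_l f xb eps g /\ v = Er g xb).

Definition radius (Q : R -> ERbar) : ERbar :=
  ERinf (fun v => exists eps, 0 < eps /\ Q eps = Fin 0 /\ v = Fin eps).

End Defs.

(* Main.v *)
(** The linear perturbations form the smallest of the three classes and the [Gamma0] ones the
    largest, so two inequalities suffice.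

    Lower bound: let [eps < r < bd_slope f xb].  Since a segment from a point of a set to a point
    outside meets its boundary, the ball of radius [r] in the dual is either contained in the
    subdifferential [S] of [f] at [xb] or disjoint from it.  In the first case
    [f u >= r * |u - xb|] for all [u].  In the second case, Hahn-Banach (a sandwich between
    [- r * |. - xb|] and [f]) produces [u] with [f u < - r * |u - xb|], which by convexity may be
    taken close to [xb].  Both properties survive an [eps]-perturbation with [r] replaced by
    [r - eps - eta], and each bounds the error bound modulus from below by that constant: the
    first directly, the second by moving along the segment to [u].

    Upper bound: let [phi] be a boundary point of [S] and [delta > 0].  Then [f - phi] is
    nonnegative after centring at [xb] and is below [delta * |u - xb|] at some [u].  Adding
    [delta] times a functional that norms [u - xb] keeps the level set in a half-space, and the
    points of the segment from [xb] to [u] show that the modulus is at most [2 * delta]. *)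
Require Import Defs.
From Stdlib Require Import Reals Lra List Classical ClassicalEpsilon FunctionalExtensionality ProofIrrelevance.
From mathcomp Require classical_sets.
Import ListNotations.
Open Scope R_scope.

(** * Extended reals *)

Lemma ERle_refl a : ERle a a.
Proof. destruct a; simpl; auto; lra. Qed.

Lemma ERle_trans a b c : ERle a b -> ERle b c -> ERle a c.
Proof. destruct a, b, c; simpl; auto; try tauto; lra. Qed.

Lemma ERle_antisym a b : ERle a b -> ERle b a -> a = b.
Proof. destruct a, b; simpl; try tauto; intros; f_equal; lra. Qed.

Lemma ERlt_not_le a b : ERlt a b <-> ~ ERle b a.
Proof.
  unfold ERlt; destruct a as [x| |], b as [y| |]; simpl; split; try tauto;
    try (intros _; split; [tauto | discriminate]).
  - intros [H N] K. apply N. f_equal. lra.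
  - intros K. split; [lra | intros [= ->]; lra].
Qed.

Lemma ERle_Fin_approx a r : (forall d, 0 < d -> ERle a (Fin (r + d))) -> ERle a (Fin r).
Proof.
  destruct a as [x| |]; simpl; intros H.
  - apply Rnot_lt_le. intros K. specialize (H ((x - r) / 2)). lra.
  - exact (H 1 Rlt_0_1).
  - exact I.
Qed.

(** [ERinf] is a choice, so every use of it rests on this existence. The cases follow the set of
    finite lower bounds: empty gives [MInf], bounded above gives its real supremum, unbounded gives
    [PInf]. *)
Lemma is_glb_exists (S : ERbar -> Prop) : exists m, is_glb S m.
Proof.
  set (L := fun r => forall y, S y -> ERle (Fin r) y).
  destruct (classic (exists r, L r)) as [[r0 Hr0]|HN].
  2:{ exists MInf. split; [intros; exact I|].
      intros [x| |] Hm; [apply HN; now exists x | | exact I].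
      apply HN. exists 0. intros y Hy. apply ERle_trans with PInf; [exact I | auto]. }
  destruct (classic (bound L)) as [HB|HB].
  - destruct (completeness L HB (ex_intro _ r0 Hr0)) as [m [Hub Hlub]].
    exists (Fin m). split.
    + intros [y| |] Hy; simpl; auto.
      * apply Hlub. intros r Hr. exact (Hr _ Hy).
      * exact (Hr0 _ Hy).
    + intros [x| |] Hm; simpl; auto.
      assert (L (m + 1)) as K.
      { intros y Hy. apply ERle_trans with PInf; [exact I | auto]. }
      specialize (Hub _ K). lra.
  - exists PInf. split.
    + intros y Hy. destruct y as [y| |]; simpl; auto.
      * apply HB. exists y. intros r Hr. exact (Hr _ Hy).
      * exact (Hr0 _ Hy).
    + intros m' _. destruct m'; simpl; auto.
Qed.

Lemma ERinf_glb (S : ERbar -> Prop) : is_glb S (ERinf S).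
Proof. unfold ERinf. apply epsilon_spec, is_glb_exists. Qed.

Lemma ERsup_lub (S : ERbar -> Prop) : Defs.is_lub S (ERsup S).
Proof.
  unfold ERsup. apply epsilon_spec.
  (* The supremum is the greatest lower bound of the set of upper bounds. *)
  destruct (is_glb_exists (fun u => forall y, S y -> ERle y u)) as [m [Hlb Hglb]].
  exists m. split; auto.
Qed.

Lemma ERinf_le (S : ERbar -> Prop) y z : S y -> ERle y z -> ERle (ERinf S) z.
Proof. intros Hy. apply ERle_trans. now apply ERinf_glb. Qed.

Lemma ERinf_ge (S : ERbar -> Prop) m : (forall y, S y -> ERle m y) -> ERle m (ERinf S).
Proof. apply ERinf_glb. Qed.

Lemma ERinf_antimono (S T : ERbar -> Prop) :
  (forall y, S y -> T y) -> ERle (ERinf T) (ERinf S).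
Proof. intros H. apply ERinf_ge. intros y Hy. apply ERinf_glb. auto. Qed.

(** * Vector identities *)

Section Vector.
Context {X : BanachSpace}.

Lemma vscal_zero (x : X) : vscal X 0 x = vzero X.
Proof.
  assert (E : vplus X x (vscal X 0 x) = x).
  { rewrite <- (vscal_one X x) at 1. rewrite <- vscal_distr_r, Rplus_0_r. apply vscal_one. }
  rewrite <- (vplus_zero X (vscal X 0 x)), <- (vplus_opp X x), vplus_assoc.
  now rewrite (vplus_comm X (vscal X 0 x)), E.
Qed.

Lemma vzero_plus (x : X) : vplus X (vzero X) x = x.
Proof. rewrite vplus_comm. apply vplus_zero. Qed.

Lemma vscal_vzero (a : R) : vscal X a (vzero X) = vzero X.
Proof. now rewrite <- (vscal_zero (vzero X)), vscal_assoc, Rmult_0_r. Qed.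

Lemma vopp_scal (x : X) : vopp X x = vscal X (-1) x.
Proof.
  rewrite <- (vzero_plus (vscal X (-1) x)), <- (vplus_opp X x).
  rewrite (vplus_comm X x), <- vplus_assoc.
  rewrite <- (vscal_one X x) at 3. rewrite <- vscal_distr_r.
  replace (1 + -1) with 0 by ring. now rewrite vscal_zero, vplus_zero.
Qed.

Lemma vplus_swap (a b c d : X) :
  vplus X (vplus X a b) (vplus X c d) = vplus X (vplus X a c) (vplus X b d).
Proof.
  rewrite <- !vplus_assoc. f_equal. rewrite !vplus_assoc. f_equal. apply vplus_comm.
Qed.

(* Both sides of a linear identity are reified and compared coefficientwise. *)
Inductive vexp : Type :=
  VAtom (n : nat) | VZero | VPlus (a b : vexp) | VOpp (a : vexp) | VScal (r : R) (a : vexp).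

Fixpoint vden (env : list X) (e : vexp) : X :=
  match e with
  | VAtom n => nth n env (vzero X)
  | VZero => vzero X
  | VPlus a b => vplus X (vden env a) (vden env b)
  | VOpp a => vopp X (vden env a)
  | VScal r a => vscal X r (vden env a)
  end.

Fixpoint vcoef (e : vexp) (i : nat) : R :=
  match e with
  | VAtom n => if Nat.eqb n i then 1 else 0
  | VZero => 0
  | VPlus a b => vcoef a i + vcoef b i
  | VOpp a => - vcoef a i
  | VScal r a => r * vcoef a i
  end.

Fixpoint lincomb (env : list X) (c : nat -> R) : X :=
  match env with
  | [] => vzero X
  | x :: l => vplus X (vscal X (c O) x) (lincomb l (fun i => c (S i)))
  end.

Fixpoint coef_eq (env : list X) (c d : nat -> R) : Prop :=
  match env with
  | [] => True
  | _ :: l => c O = d O /\ coef_eq l (fun i => c (S i)) (fun i => d (S i))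
  end.

Lemma lincomb_ext env c d : coef_eq env c d -> lincomb env c = lincomb env d.
Proof.
  revert c d; induction env as [|x l IH]; simpl; intros c d; [easy|].
  intros [-> H]. now rewrite (IH _ _ H).
Qed.

Lemma lincomb_zero env c : (forall i, c i = 0) -> lincomb env c = vzero X.
Proof.
  revert c; induction env as [|x l IH]; simpl; intros c H; [easy|].
  rewrite H, vscal_zero, vzero_plus. apply IH. auto.
Qed.

Lemma lincomb_atom env n :
  lincomb env (fun i => if Nat.eqb n i then 1 else 0) = nth n env (vzero X).
Proof.
  revert n; induction env as [|x l IH]; intros [|n]; simpl; auto.
  - rewrite lincomb_zero by easy. now rewrite vplus_zero, vscal_one.
  - now rewrite vscal_zero, vzero_plus, IH.
Qed.

Lemma lincomb_plus env c d :
  lincomb env (fun i => c i + d i) = vplus X (lincomb env c) (lincomb env d).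
Proof.
  revert c d; induction env as [|x l IH]; simpl; intros c d.
  - now rewrite vplus_zero.
  - rewrite vscal_distr_r, (IH (fun i => c (S i))). apply vplus_swap.
Qed.

Lemma lincomb_scal env a c : lincomb env (fun i => a * c i) = vscal X a (lincomb env c).
Proof.
  revert c; induction env as [|x l IH]; simpl; intros c.
  - now rewrite vscal_vzero.
  - now rewrite (IH (fun i => c (S i))), vscal_distr_l, vscal_assoc.
Qed.

Lemma vden_lincomb env e : vden env e = lincomb env (vcoef e).
Proof.
  induction e as [n| |a IHa b IHb|a IHa|r a IHa]; simpl.
  - symmetry. apply lincomb_atom.
  - symmetry. now apply lincomb_zero.
  - now rewrite IHa, IHb, <- lincomb_plus.
  - rewrite IHa, vopp_scal, <- lincomb_scal. f_equal. extensionality i. ring.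
  - now rewrite IHa, <- lincomb_scal.
Qed.

Lemma vden_eq env e1 e2 : coef_eq env (vcoef e1) (vcoef e2) -> vden env e1 = vden env e2.
Proof. intros H. rewrite !vden_lincomb. now apply lincomb_ext. Qed.

End Vector.

Ltac vindex x l :=
  lazymatch l with
  | x :: _ => constr:(O)
  | _ :: ?t => let n := vindex x t in constr:(S n)
  end.

Ltac vatoms l t :=
  lazymatch t with
  | vzero _ => l
  | vplus _ ?a ?b => let l1 := vatoms l a in vatoms l1 b
  | vopp _ ?a => vatoms l a
  | vscal _ _ ?a => vatoms l a
  | _ => match l with
         (* [vindex] fails on a new atom, and the plain [match] then backtracks to the branch that
            adds it. *)
         | _ => let _ := vindex t l in l
         | _ => constr:(t :: l)
         end
  end.

Ltac vreify l t :=
  lazymatch t with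
  | vzero _ => constr:(VZero)
  | vplus _ ?a ?b => let u := vreify l a in let v := vreify l b in constr:(VPlus u v)
  | vopp _ ?a => let u := vreify l a in constr:(VOpp u)
  | vscal _ ?r ?a => let u := vreify l a in constr:(VScal r u)
  | _ => let n := vindex t l in constr:(VAtom n)
  end.

Ltac vec :=
  unfold vminus;
  lazymatch goal with
  | |- @eq (carrier ?X) ?a ?b =>
      let l0 := constr:(@nil (carrier X)) in
      let l1 := vatoms l0 a in let l := vatoms l1 b in
      let u := vreify l a in let v := vreify l b in
      change (vden l u = vden l v); apply vden_eq;
      cbn [coef_eq vcoef Nat.eqb];
      repeat match goal with |- _ /\ _ => split | |- True => exact I end;
      try (field; try lra)
  end.

(** * Elementary properties of the norm *)

Section Norm.
Context {X : BanachSpace}.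

Lemma nrm_zero : nrm (vzero X) = 0.
Proof.
  unfold nrm. rewrite <- (vscal_zero (vzero X)), vnorm_scal, Rabs_R0. ring.
Qed.

Lemma nrm_opp (x : X) : nrm (vopp X x) = nrm x.
Proof. unfold nrm. rewrite vopp_scal, vnorm_scal, Rabs_left; lra. Qed.

Lemma nrm_scal_pos (a : R) (x : X) : 0 <= a -> nrm (vscal X a x) = a * nrm x.
Proof. intros Ha. unfold nrm. rewrite vnorm_scal, Rabs_pos_eq; lra. Qed.

Lemma nrm_minus_sym (x y : X) : nrm (vminus x y) = nrm (vminus y x).
Proof. rewrite <- nrm_opp. f_equal. vec. Qed.

Lemma nrm_triangle_minus (x y z : X) : nrm (vminus x z) <= nrm (vminus x y) + nrm (vminus y z).
Proof.
  replace (vminus x z) with (vplus X (vminus x y) (vminus y z)) by vec.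
  apply vnorm_triangle.
Qed.

End Norm.

(** * Hahn-Banach *)

(** Transfers the boolean form of Zorn's lemma to [Prop]-valued orders through [asbool]. *)
Lemma Zorn_Prop (T : Type) (R : T -> T -> Prop) :
  (forall t, R t t) -> (forall r s t, R r s -> R s t -> R r t) ->
  (forall s t, R s t -> R t s -> s = t) ->
  (forall A : T -> Prop, (forall s t, A s -> A t -> R s t \/ R t s) ->
     exists t, forall s, A s -> R s t) ->
  exists t, forall s, R t s -> s = t.
Proof.
  intros Hr Ht Ha Hc.
  destruct (@classical_sets.Zorn T (fun s t => boolp.asbool (R s t))) as [t H].
  - intros t. apply boolp.asboolT, Hr.
  - intros r s t H1 H2. apply boolp.asboolT.
    apply Ht with s; apply boolp.asboolW; assumption.
  - intros s t H1 H2. apply Ha; apply boolp.asboolW; assumption.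
  - intros A HA. destruct (Hc A) as [t H].
    + intros s t H1 H2. destruct (HA s t H1 H2) as [H|H]; apply boolp.asboolW in H; auto.
    + exists t. intros s Hs. apply boolp.asboolT. auto.
  - exists t. intros s Hs. apply H, boolp.asboolT, Hs.
Qed.

(** * Infima of sets of reals *)

Definition lower_bound (E : R -> Prop) (m : R) : Prop := forall y, E y -> m <= y.

(** A total function, so that infima can define functionals on [X]; its value is meaningful for
    nonempty sets bounded below. *)
Definition real_inf (E : R -> Prop) : R :=
  epsilon (inhabits 0) (fun m => lower_bound E m /\ forall l, lower_bound E l -> l <= m).

Lemma real_inf_spec (E : R -> Prop) l :
  (exists y, E y) -> lower_bound E l ->
  lower_bound E (real_inf E) /\ forall l', lower_bound E l' -> l' <= real_inf E.
Proof.
  intros [y0 Hy0] Hl. unfold real_inf. apply epsilon_spec.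
  destruct (completeness (lower_bound E)) as [m [Hub Hlub]].
  - exists y0. intros l' H'. auto.
  - now exists l.
  - exists m. split; [|exact Hub].
    intros y Hy. apply Hlub. intros l' H'. auto.
Qed.

Section HahnBanach.
Context {X : BanachSpace}.

(** Homogeneity is an inequality for positive scalars, the form that infima satisfy directly;
    equality follows by applying it to [/ t] as well. *)
Definition sublinear (q : X -> R) : Prop :=
  (forall x y, q (vplus X x y) <= q x + q y) /\
  (forall t x, 0 < t -> q (vscal X t x) <= t * q x).

Lemma sublinear_zero q : sublinear q -> q (vzero X) = 0.
Proof.
  intros [Ha Hh].
  pose proof (Ha (vzero X) (vzero X)) as H1. rewrite vplus_zero in H1.
  assert (0 < / 2) as P by lra.
  pose proof (Hh _ (vzero X) P) as H2. rewrite vscal_vzero in H2. lra.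
Qed.

Lemma sublinear_opp q x : sublinear q -> - q (vopp X x) <= q x.
Proof.
  intros Hq. pose proof (sublinear_zero _ Hq) as H0. destruct Hq as [Ha _].
  specialize (Ha x (vopp X x)). rewrite vplus_opp, H0 in Ha. lra.
Qed.

Lemma sublinear_scal q t x : sublinear q -> 0 <= t -> q (vscal X t x) = t * q x.
Proof.
  intros Hq [Ht|<-].
  - destruct Hq as [_ Hh]. apply Rle_antisym; [auto|].
    pose proof (Hh (/ t) (vscal X t x) (Rinv_0_lt_compat _ Ht)) as H.
    rewrite vscal_assoc, Rinv_l, vscal_one in H by lra.
    apply Rmult_le_reg_l with (/ t); [now apply Rinv_0_lt_compat|].
    rewrite <- Rmult_assoc, Rinv_l, Rmult_1_l by lra. exact H.
  - rewrite vscal_zero, sublinear_zero by exact Hq. ring.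
Qed.

(** Common criterion for three constructions below: the directional derivative, the infimum of a
    chain, and the convolution in [convex_sandwich]. The minorant [l] keeps the infima finite. *)
Lemma real_inf_sublinear (E : X -> R -> Prop) (l : X -> R) :
  (forall x, exists c, E x c) -> (forall x, lower_bound (E x) (l x)) ->
  (forall x y a b, E x a -> E y b -> exists c, E (vplus X x y) c /\ c <= a + b) ->
  (forall t x a, 0 < t -> E x a -> exists c, E (vscal X t x) c /\ c <= t * a) ->
  sublinear (fun x => real_inf (E x)).
Proof.
  intros Hne Hl Hadd Hscal.
  pose proof (fun x => real_inf_spec (E x) (l x) (Hne x) (Hl x)) as Hs.
  split.
  - intros x y.
    enough (real_inf (E (vplus X x y)) - real_inf (E y) <= real_inf (E x)) by lra.
    apply Hs. intros a Ha.
    enough (real_inf (E (vplus X x y)) - a <= real_inf (E y)) by lra.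
    apply Hs. intros b Hb.
    destruct (Hadd _ _ _ _ Ha Hb) as (c & Hc & Hcab).
    apply (proj1 (Hs (vplus X x y))) in Hc. lra.
  - intros t x Ht.
    enough (real_inf (E (vscal X t x)) / t <= real_inf (E x)) as H.
    { apply Rmult_le_compat_l with (r := t) in H; [|lra].
      now replace (t * (real_inf (E (vscal X t x)) / t)) with (real_inf (E (vscal X t x)))
        in H by (field; lra). }
    apply Hs. intros a Ha.
    destruct (Hscal _ _ _ Ht Ha) as (c & Hc & Hca).
    apply (proj1 (Hs (vscal X t x))) in Hc.
    apply Rmult_le_reg_l with t; [exact Ht|].
    replace (t * (real_inf (E (vscal X t x)) / t)) with (real_inf (E (vscal X t x)))
      by (field; lra). lra.
Qed.

(* The directional derivative of [q] at [y]: a sublinear minorant of [q], linear along [y]. *)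
Lemma sublinear_tilt q y : sublinear q ->
  exists q', sublinear q' /\ (forall x, q' x <= q x) /\
    forall x, q' x <= q (vplus X x y) - q y.
Proof.
  intros Hq.
  (* The parameter [t = 0] yields the bound by [q], and [t = 1] the bound along [y]. *)
  set (E := fun x c => exists t, 0 <= t /\ c = q (vplus X x (vscal X t y)) - t * q y).
  set (l := fun x => - q (vopp X x)).
  assert (Hne : forall x, exists c, E x c).
  { intros x. eexists. exists 0. split; [lra | reflexivity]. }
  assert (Hl : forall x, lower_bound (E x) (l x)).
  (* Subadditivity gives [t * q y = q (t y) <= q (x + t y) + q (- x)]. *)
  { intros x c (t & Ht & ->). unfold l.
    rewrite <- (sublinear_scal q t y Hq Ht).
    replace (vscal X t y) with (vplus X (vplus X x (vscal X t y)) (vopp X x)) at 2 by vec.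
    destruct Hq as [Ha _].
    pose proof (Ha (vplus X x (vscal X t y)) (vopp X x)). lra. }
  pose proof (fun x => real_inf_spec (E x) (l x) (Hne x) (Hl x)) as Hs.
  exists (fun x => real_inf (E x)). split; [|split].
  - apply real_inf_sublinear with l; auto.
    + intros x z a b (s & Hs0 & ->) (t & Ht0 & ->).
      eexists. split; [exists (s + t); split; [lra|reflexivity]|].
      replace (vplus X (vplus X x z) (vscal X (s + t) y))
        with (vplus X (vplus X x (vscal X s y)) (vplus X z (vscal X t y))) by vec.
      destruct Hq as [Ha _].
      pose proof (Ha (vplus X x (vscal X s y)) (vplus X z (vscal X t y))). lra.
    + intros s x a Hs0 (t & Ht0 & ->).
      eexists. split; [exists (s * t); split; [nra|reflexivity]|].
      replace (vplus X (vscal X s x) (vscal X (s * t) y))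
        with (vscal X s (vplus X x (vscal X t y))) by vec.
      rewrite (sublinear_scal q s) by (auto; lra). lra.
  - intros x. apply Hs. exists 0. split; [lra|].
    rewrite vscal_zero, vplus_zero. ring.
  - intros x. apply Hs. exists 1. split; [lra|].
    rewrite vscal_one. ring.
Qed.

(** Zorn's lemma for the reversed pointwise order: the pointwise infimum of a chain is again
    sublinear, because two members can be replaced by the smaller one. *)
Lemma sublinear_minimal p : sublinear p ->
  exists q, sublinear q /\ (forall x, q x <= p x) /\
    forall q', sublinear q' -> (forall x, q' x <= q x) -> q' = q.
Proof.
  intros Hp.
  set (T := {q : X -> R | sublinear q /\ forall x, q x <= p x}).
  destruct (Zorn_Prop T (fun q1 q2 => forall x, proj1_sig q2 x <= proj1_sig q1 x))
    as [[q [Hq Hqp]] Hmin].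
  - intros t x. lra.
  - intros r s t H1 H2 x. specialize (H1 x). specialize (H2 x). lra.
  - intros [s Hs] [t Ht] H1 H2. simpl in *.
    assert (s = t) as <- by (extensionality x; apply Rle_antisym; auto).
    f_equal. apply proof_irrelevance.
  - intros A HA.
    (* Including [p x] covers the empty chain and keeps the infimum below [p]. *)
    set (E := fun x c => c = p x \/ exists s : T, A s /\ c = proj1_sig s x).
    set (l := fun x => - p (vopp X x)).
    assert (Hne : forall x, exists c, E x c) by (intros x; exists (p x); now left).
    assert (Hl : forall x, lower_bound (E x) (l x)).
    { intros x c [->|([s [Hs Hsp]] & _ & ->)]; unfold l.
      - now apply sublinear_opp.
      - simpl. pose proof (sublinear_opp s x Hs). specialize (Hsp (vopp X x)). lra. }
    pose proof (fun x => real_inf_spec (E x) (l x) (Hne x) (Hl x)) as Hs.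
    assert (Hi : sublinear (fun x => real_inf (E x))).
    { apply real_inf_sublinear with l; auto.
      - assert (K : forall s : T, A s -> forall x y,
          proj1_sig s (vplus X x y) <= proj1_sig s x + proj1_sig s y)
          by (intros [s Hs0] _; apply Hs0).
        assert (L : forall s : T, forall x, proj1_sig s x <= p x)
          by (intros [s Hs0]; apply Hs0).
        intros x y a b [->|(s & Hs1 & ->)] [->|(t & Ht1 & ->)].
        + exists (p (vplus X x y)). split; [now left | apply Hp].
        + exists (proj1_sig t (vplus X x y)). split; [right; now exists t|].
          pose proof (K t Ht1 x y). pose proof (L t x). lra.
        + exists (proj1_sig s (vplus X x y)). split; [right; now exists s|].
          pose proof (K s Hs1 x y). pose proof (L s y). lra.
        + destruct (HA s t Hs1 Ht1) as [H|H].
          * exists (proj1_sig t (vplus X x y)). split; [right; now exists t|].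
            pose proof (K t Ht1 x y). pose proof (H x). lra.
          * exists (proj1_sig s (vplus X x y)). split; [right; now exists s|].
            pose proof (K s Hs1 x y). pose proof (H y). lra.
      - intros t x a Ht [->|([s Hs0] & Hs1 & ->)].
        + exists (p (vscal X t x)). split; [now left | now apply Hp].
        + exists (s (vscal X t x)). split; [|now apply Hs0].
          right. now exists (exist _ s Hs0). }
    assert (Hip : forall x, real_inf (E x) <= p x) by (intros x; apply Hs; now left).
    exists (exist _ (fun x => real_inf (E x)) (conj Hi Hip)).
    intros s HsA x. simpl. apply Hs. right. now exists s.
  - exists q. split; [exact Hq|split; [exact Hqp|]].
    intros q' Hq' Hle.
    assert (Hq'p : forall x, q' x <= p x) by (intros x; apply Rle_trans with (q x); auto).
    specialize (Hmin (exist _ q' (conj Hq' Hq'p)) Hle).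
    exact (f_equal (@proj1_sig _ _) Hmin).
Qed.

(** A minimal sublinear [q] coincides with its tilt along any [y], so [q x <= q (x + y) - q y]. This
    is superadditivity, hence [q] is additive. *)
Lemma hahn_banach p : sublinear p ->
  exists phi : X -> R,
    (forall x y, phi (vplus X x y) = phi x + phi y) /\
    (forall a x, phi (vscal X a x) = a * phi x) /\ forall x, phi x <= p x.
Proof.
  intros Hp. destruct (sublinear_minimal p Hp) as (q & Hq & Hqp & Hmin).
  assert (Hadd : forall x y, q (vplus X x y) = q x + q y).
  { intros x y. destruct (sublinear_tilt q y Hq) as (q' & Hq' & Hle & Ht).
    specialize (Ht x). rewrite (Hmin q' Hq' Hle) in Ht.
    destruct Hq as [Ha _]. specialize (Ha x y). lra. }
  exists q. repeat split; [exact Hadd | | exact Hqp].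
  intros a x. destruct (Rle_or_lt 0 a) as [Ha|Ha]; [now apply sublinear_scal|].
  assert (E : q (vplus X (vscal X a x) (vscal X (- a) x)) = 0).
  { replace (vplus X (vscal X a x) (vscal X (- a) x)) with (vzero X) by vec.
    now apply sublinear_zero. }
  rewrite Hadd, (sublinear_scal q (- a)) in E by (auto; lra). lra.
Qed.

Lemma linear_opp (phi : X -> R) :
  (forall a x, phi (vscal X a x) = a * phi x) -> forall x, phi (vopp X x) = - phi x.
Proof. intros H x. rewrite vopp_scal, H. ring. Qed.

Lemma linear_abs_le (phi : X -> R) r :
  (forall a x, phi (vscal X a x) = a * phi x) -> (forall x, phi x <= r * nrm x) ->
  forall x, Rabs (phi x) <= r * nrm x.
Proof.
  intros Hs H x. apply Rabs_le. split; [|apply H].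
  specialize (H (vopp X x)). rewrite nrm_opp, (linear_opp phi Hs) in H. lra.
Qed.

(** A linear minorant of the norm tilted along [v] satisfies [phi (- v) <= - nrm v], which forces
    equality at [v]. *)
Lemma norming_functional (v : X) :
  exists phi, is_dual phi /\ phi v = nrm v /\ forall x, Rabs (phi x) <= nrm x.
Proof.
  assert (Hn : sublinear (@nrm X)).
  { split; [apply vnorm_triangle|]. intros t x Ht. rewrite nrm_scal_pos; lra. }
  destruct (sublinear_tilt _ v Hn) as (q & Hq & Hqn & Hqv).
  destruct (hahn_banach q Hq) as (phi & Ha & Hs & Hle).
  assert (B : forall x, Rabs (phi x) <= 1 * nrm x).
  { apply linear_abs_le; [exact Hs|].
    intros x. rewrite Rmult_1_l. apply Rle_trans with (q x); auto. }
  exists phi. split; [|split].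
  - split; [exact Ha|split; [exact Hs|]]. now exists 1.
  - apply Rle_antisym.
    + apply Rle_trans with (q v); auto.
    + specialize (Hle (vopp X v)). specialize (Hqv (vopp X v)).
      rewrite (vplus_comm X (vopp X v)), vplus_opp, nrm_zero in Hqv.
      rewrite (linear_opp phi Hs) in Hle. lra.
  - intros x. rewrite <- (Rmult_1_l (nrm x)). apply B.
Qed.

(** Hahn-Banach is applied to the infimal convolution of [r * nrm] with the positively homogeneous
    hull of [h]. Convexity of [h] makes it subadditive, and the lower bound on [h] makes it finite.
    A linear minorant lies below [r * nrm] (take [w = 0]) and below [h] (take [t = 1], [w = v]). *)
Lemma convex_sandwich (h : X -> ERbar) r : 0 <= r ->
  convex h -> h (vzero X) = Fin 0 -> (forall v, ERle (Fin (- r * nrm v)) (h v)) ->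
  exists phi, is_dual phi /\ (forall x, Rabs (phi x) <= r * nrm x) /\
    forall v, ERle (Fin (phi v)) (h v).
Proof.
  intros Hr Hc H0 Hb.
  set (E := fun v c => exists t w a, 0 < t /\ h (vscal X t w) = Fin a /\
                         c = a / t + r * nrm (vminus v w)).
  set (l := fun v : X => - r * nrm v).
  assert (Hne : forall x, exists c, E x c).
  { intros x. eexists. exists 1, (vzero X), 0. rewrite vscal_vzero. repeat split; auto; lra. }
  assert (Hl : forall x, lower_bound (E x) (l x)).
  { intros x c (t & w & a & Ht & Ha & ->). unfold l.
    specialize (Hb (vscal X t w)). rewrite Ha, nrm_scal_pos in Hb by lra. simpl in Hb.
    assert (- r * nrm w <= a / t) as H1.
    { apply Rmult_le_reg_l with t; [exact Ht|].
      replace (t * (a / t)) with a by (field; lra). lra. }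
    assert (nrm w <= nrm x + nrm (vminus x w)) as H2.
    { rewrite (nrm_minus_sym x w).
      replace w with (vplus X x (vminus w x)) at 1 by vec. apply vnorm_triangle. }
    nra. }
  pose proof (fun x => real_inf_spec (E x) (l x) (Hne x) (Hl x)) as Hs.
  assert (Hp : sublinear (fun x => real_inf (E x))).
  { apply real_inf_sublinear with l; auto.
    - intros x y ? ? (t1 & w1 & a1 & Ht1 & Ha1 & ->) (t2 & w2 & a2 & Ht2 & Ha2 & ->).
      assert (0 < t1 * t2) by nra.
      (* With this weight the convex combination of [t1 w1] and [t2 w2] is a multiple of [w1 + w2].
         Dividing the combined values by the factor [t1 * t2 / (t1 + t2)] leaves
         [a1 / t1 + a2 / t2]. *)
      assert (Hlam : 0 <= t2 / (t1 + t2) <= 1).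
      { split; [apply Rmult_le_pos; [lra|]; left; apply Rinv_0_lt_compat; lra|].
        apply Rmult_le_reg_r with (t1 + t2); [lra|].
        replace (t2 / (t1 + t2) * (t1 + t2)) with t2 by (field; lra). lra. }
      pose proof (Hc _ _ _ _ _ Ha1 Ha2 Hlam) as K.
      replace (vplus X _ _) with (vscal X (t1 * t2 / (t1 + t2)) (vplus X w1 w2)) in K by vec.
      pose proof (Hb (vscal X (t1 * t2 / (t1 + t2)) (vplus X w1 w2))) as Kb.
      destruct (h (vscal X (t1 * t2 / (t1 + t2)) (vplus X w1 w2))) as [a| |] eqn:Ea;
        try easy.
      assert (Ht : 0 < t1 * t2 / (t1 + t2)) by (apply Rdiv_lt_0_compat; lra).
      eexists. split; [exists (t1 * t2 / (t1 + t2)), (vplus X w1 w2), a; repeat split; auto|].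
      simpl in K.
      assert (a / (t1 * t2 / (t1 + t2)) <= a1 / t1 + a2 / t2).
      { apply Rmult_le_reg_r with (t1 * t2 / (t1 + t2)); [exact Ht|].
        replace (a / (t1 * t2 / (t1 + t2)) * (t1 * t2 / (t1 + t2))) with a
          by (field; lra).
        replace ((a1 / t1 + a2 / t2) * (t1 * t2 / (t1 + t2)))
          with (t2 / (t1 + t2) * a1 + (1 - t2 / (t1 + t2)) * a2) by (field; lra).
        exact K. }
      assert (nrm (vminus (vplus X x y) (vplus X w1 w2))
              <= nrm (vminus x w1) + nrm (vminus y w2)).
      { replace (vminus (vplus X x y) (vplus X w1 w2))
          with (vplus X (vminus x w1) (vminus y w2)) by vec. apply vnorm_triangle. }
      nra.
    - intros s x c Hs0 (t & w & a & Ht & Ha & ->).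
      eexists. split.
      { exists (t / s), (vscal X s w), a. split; [now apply Rdiv_lt_0_compat|].
        replace (vscal X (t / s) (vscal X s w)) with (vscal X t w) by vec.
        split; [exact Ha | reflexivity]. }
      replace (vminus (vscal X s x) (vscal X s w)) with (vscal X s (vminus x w)) by vec.
      rewrite nrm_scal_pos by lra. right. field. lra. }
  destruct (hahn_banach _ Hp) as (phi & Hadd & Hscal & Hle).
  assert (B : forall x, Rabs (phi x) <= r * nrm x).
  { apply linear_abs_le; [exact Hscal|]. intros x.
    apply Rle_trans with (real_inf (E x)); [apply Hle|].
    apply Hs. exists 1, (vzero X), 0. rewrite vscal_vzero. repeat split; [lra|exact H0|].
    replace (vminus x (vzero X)) with x by vec. lra. }
  exists phi. split; [|split; [exact B|]].
  - split; [exact Hadd|split; [exact Hscal|]]. now exists r.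
  - intros v. specialize (Hb v). destruct (h v) as [a| |] eqn:Ea; simpl; try easy.
    apply Rle_trans with (real_inf (E v)); [apply Hle|].
    apply Hs. exists 1, v, a. rewrite vscal_one. repeat split; [lra|exact Ea|].
    replace (vminus v v) with (vzero X) by vec. rewrite nrm_zero. lra.
Qed.

End HahnBanach.

(** * Dual norm and boundary points *)

Section Dual.
Context {X : BanachSpace}.
Implicit Types (phi psi : X -> R) (x y u v : X).

Lemma dual_minus phi x y : is_dual phi -> phi (vminus x y) = phi x - phi y.
Proof.
  intros (Ha & Hs & _). unfold vminus. rewrite Ha, (linear_opp phi Hs). ring.
Qed.

Lemma dual_zero phi : is_dual phi -> phi (vzero X) = 0.
Proof. intros (_ & Hs & _). rewrite <- (vscal_zero (vzero X)), Hs. ring. Qed.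

Lemma dual_comb a b phi psi :
  is_dual phi -> is_dual psi -> is_dual (fun x => a * phi x + b * psi x).
Proof.
  intros (A1 & S1 & M1 & B1) (A2 & S2 & M2 & B2). split; [|split].
  - intros x y. rewrite A1, A2. ring.
  - intros c x. rewrite S1, S2. ring.
  - exists (Rabs a * M1 + Rabs b * M2). intros x.
    eapply Rle_trans; [apply Rabs_triang|]. rewrite !Rabs_mult.
    pose proof (Rmult_le_compat_l _ _ _ (Rabs_pos a) (B1 x)).
    pose proof (Rmult_le_compat_l _ _ _ (Rabs_pos b) (B2 x)). lra.
Qed.

Lemma dual_scal a phi : is_dual phi -> is_dual (fun x => a * phi x).
Proof.
  intros H. replace (fun x => a * phi x) with (fun x => a * phi x + 0 * phi x).
  - now apply dual_comb.
  - extensionality x. ring.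
Qed.

Lemma dual_dminus phi psi : is_dual phi -> is_dual psi -> is_dual (dminus phi psi).
Proof.
  intros Hphi Hpsi.
  replace (dminus phi psi) with (fun x => 1 * phi x + (-1) * psi x).
  - now apply dual_comb.
  - extensionality x. unfold dminus. ring.
Qed.

Lemma dnorm_le phi r : 0 <= r ->
  (forall x, Rabs (phi x) <= r * nrm x) -> ERle (dnorm phi) (Fin r).
Proof.
  intros Hr H. apply ERsup_lub. intros y (x & Hx & ->). simpl.
  specialize (H x). nra.
Qed.

Lemma dnorm_bound phi r : is_dual phi ->
  ERle (dnorm phi) (Fin r) -> forall x, Rabs (phi x) <= r * nrm x.
Proof.
  intros Hd H x. destruct (vnorm_nonneg X x) as [Hx|Hx].
  2:{ fold (nrm x) in Hx. symmetry in Hx. rewrite Hx.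
      rewrite (vnorm_eq0 X x Hx), dual_zero, Rabs_R0 by exact Hd. lra. }
  fold (nrm x) in Hx.
  assert (Hi : 0 < / nrm x) by now apply Rinv_0_lt_compat.
  assert (K : ERle (Fin (Rabs (phi (vscal X (/ nrm x) x)))) (Fin r)).
  { eapply ERle_trans; [|exact H]. apply ERsup_lub.
    exists (vscal X (/ nrm x) x). split; [|reflexivity].
    rewrite nrm_scal_pos, Rinv_l; lra. }
  destruct Hd as (_ & Hs & _). simpl in K.
  rewrite Hs, Rabs_mult, (Rabs_pos_eq (/ nrm x)) in K by lra.
  apply Rmult_le_reg_l with (/ nrm x); [exact Hi|].
  replace (/ nrm x * (r * nrm x)) with r by (field; lra). exact K.
Qed.

Lemma dnorm_finite phi : is_dual phi -> exists r, 0 <= r /\ dnorm phi = Fin r.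
Proof.
  intros Hd. pose proof Hd as (_ & _ & M & HM).
  assert (H1 : ERle (dnorm phi) (Fin (Rabs M))).
  { apply dnorm_le; [apply Rabs_pos|]. intros x.
    eapply Rle_trans; [apply HM|]. apply Rmult_le_compat_r; [apply vnorm_nonneg|apply Rle_abs]. }
  assert (H0 : ERle (Fin 0) (dnorm phi)).
  { apply ERsup_lub. exists (vzero X). rewrite nrm_zero, dual_zero, Rabs_R0 by exact Hd.
    split; [lra|reflexivity]. }
  destruct (dnorm phi) as [r| |]; try easy. exists r. auto.
Qed.

(** The transition point is the supremum of the parameters in the unit interval where [P] holds. *)
Lemma unit_interval_transition (P : R -> Prop) : P 0 -> ~ P 1 ->
  exists t, 0 <= t <= 1 /\ forall e, 0 < e ->
    (exists a, Rabs (a - t) < e /\ P a) /\ (exists b, Rabs (b - t) < e /\ ~ P b).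
Proof.
  intros P0 P1. set (E := fun t => 0 <= t <= 1 /\ P t).
  destruct (completeness E) as [t [Hub Hlub]].
  { exists 1. intros x [Hx _]. lra. }
  { exists 0. split; [lra|exact P0]. }
  assert (H0 : 0 <= t) by (apply Hub; split; [lra|exact P0]).
  assert (H1 : t <= 1) by (apply Hlub; intros x [Hx _]; lra).
  exists t. split; [lra|]. intros e He. split.
  - apply NNPP. intros N.
    assert (is_upper_bound E (t - e)) as K.
    { intros a [Ha Pa]. apply Rnot_lt_le. intros La. apply N. exists a. split; [|exact Pa].
      assert (a <= t) by (apply Hub; now split). apply Rabs_def1; lra. }
    apply Hlub in K. lra.
  (* At the cap [1], [P] fails by hypothesis; below it, [P] fails because the parameter exceeds the
     supremum. *)
  - exists (Rmin 1 (t + e / 2)).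
    destruct (Rle_or_lt 1 (t + e / 2)) as [L|L].
    + rewrite Rmin_left by lra. split; [apply Rabs_def1; lra | exact P1].
    + rewrite Rmin_right by lra. split; [apply Rabs_def1; lra|].
      intros K. assert (t + e / 2 <= t) by (apply Hub; split; [lra|exact K]). lra.
Qed.

Lemma bd_segment (S : (X -> R) -> Prop) psi : is_dual psi ->
  ~ (S (fun _ => 0) <-> S psi) ->
  exists t, 0 <= t <= 1 /\ bd S (fun x => t * psi x).
Proof.
  intros Hd HN.
  set (P := fun t => S (fun x => t * psi x)).
  assert (E0 : P 0 <-> S (fun _ => 0)).
  { unfold P. replace (fun x => 0 * psi x) with (fun _ : X => 0); [tauto|].
    extensionality x. ring. }
  assert (E1 : P 1 <-> S psi).
  { unfold P. replace (fun x => 1 * psi x) with psi; [tauto|].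
    extensionality x. ring. }
  assert (HT : exists t, 0 <= t <= 1 /\ forall e, 0 < e ->
    (exists a, Rabs (a - t) < e /\ P a) /\ (exists b, Rabs (b - t) < e /\ ~ P b)).
  { destruct (classic (P 0)) as [P0|P0].
    - apply unit_interval_transition; tauto.
    (* If [P] fails at [0] it holds at [1], so the complement is used. *)
    - destruct (unit_interval_transition (fun t => ~ P t)) as (t & Ht & H); [tauto|tauto|].
      exists t. split; [exact Ht|]. intros e He.
      destruct (H e He) as [[a Ha] (b & Hb & Pb)]. split.
      + exists b. split; [exact Hb|]. now apply NNPP.
      + now exists a. }
  destruct HT as (t & Ht & H). exists t. split; [exact Ht|].
  split; [now apply dual_scal|]. intros r Hr.
  destruct (dnorm_finite psi Hd) as (M & HM & EM).
  assert (B : forall x, Rabs (psi x) <= M * nrm x).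
  { apply dnorm_bound; [exact Hd|]. rewrite EM. apply ERle_refl. }
  (* [M + 1] avoids division by zero when [psi] vanishes, and [r / 2] leaves room for the strict
     inequality after passing to the supremum in [dnorm]. *)
  assert (He : 0 < r / 2 / (M + 1)) by (apply Rdiv_lt_0_compat; lra).
  assert (D : forall a, Rabs (a - t) < r / 2 / (M + 1) ->
    ERlt (dnorm (dminus (fun x => a * psi x) (fun x => t * psi x))) (Fin r)).
  { intros a Ha. apply ERlt_not_le. intros K.
    assert (K2 : ERle (Fin r) (Fin (r / 2))).
    { eapply ERle_trans; [exact K|]. apply dnorm_le; [lra|]. intros x. unfold dminus.
      replace (a * psi x - t * psi x) with ((a - t) * psi x) by ring.
      rewrite Rabs_mult.
      apply Rle_trans with (r / 2 / (M + 1) * (M * nrm x)).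
      - apply Rmult_le_compat; auto using Rabs_pos; lra.
      - rewrite <- Rmult_assoc. apply Rmult_le_compat_r; [apply vnorm_nonneg|].
        apply Rle_trans with (r / 2 / (M + 1) * (M + 1)); [|right; field; lra].
        apply Rmult_le_compat_l; lra. }
    simpl in K2. lra. }
  destruct (H _ He) as [(a & Ha & Pa) (b & Hb & Pb)]. split.
  - exists (fun x => a * psi x). split; [now apply dual_scal|]. split; auto.
  - exists (fun x => b * psi x). split; [now apply dual_scal|]. split; auto.
Qed.

Lemma subdiff_at_zero (f : X -> ERbar) xb phi : f xb = Fin 0 ->
  subdiff f xb phi <-> is_dual phi /\ forall u, ERle (Fin (phi (vminus u xb))) (f u).
Proof.
  intros H0. unfold subdiff. rewrite H0.
  split; intros [Hd H]; split; auto; intros u; specialize (H u);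
    now rewrite Rplus_0_r in *.
Qed.

(** Otherwise the segment from [0] to [psi] would contain a boundary point, of norm at most [r]. *)
Lemma bd_slope_ball (f : X -> ERbar) xb r psi : 0 <= r ->
  ERlt (Fin r) (bd_slope f xb) -> is_dual psi -> (forall x, Rabs (psi x) <= r * nrm x) ->
  (subdiff f xb (fun _ => 0) <-> subdiff f xb psi).
Proof.
  intros Hr Hs Hd Hb. apply NNPP. intros HN.
  destruct (bd_segment _ psi Hd HN) as (t & Ht & Hbd).
  apply ERlt_not_le in Hs. apply Hs.
  eapply ERinf_le; [exists (fun x => t * psi x); split; [exact Hbd|reflexivity]|].
  apply dnorm_le; [exact Hr|]. intros x. rewrite Rabs_mult, (Rabs_pos_eq t) by lra.
  specialize (Hb x). pose proof (Rabs_pos (psi x)). nra.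
Qed.

(* The boundary slope exceeds [r] in one of two ways: the ball of radius [r] is contained in
   the subdifferential, or is disjoint from it. *)
Lemma bd_slope_dichotomy (f : X -> ERbar) xb r :
  Gamma0 f -> f xb = Fin 0 -> 0 <= r -> ERlt (Fin r) (bd_slope f xb) ->
  (forall u, ERle (Fin (r * nrm (vminus u xb))) (f u)) \/
  (exists u a, f u = Fin a /\ a < - r * nrm (vminus u xb)).
Proof.
  intros ([Hp _] & Hc & _) H0 Hr Hs.
  destruct (classic (subdiff f xb (fun _ => 0))) as [HS|HS].
  - left. intros u.
    destruct (norming_functional (vminus u xb)) as (nu & Hd & Hn & Hb).
    (* The multiple [r * nu] lies in the ball and attains [r * nrm (vminus u xb)] at
       [vminus u xb]. *)
    assert (K : subdiff f xb (fun x => r * nu x)).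
    { apply (bd_slope_ball f xb r); auto using dual_scal.
      intros x. rewrite Rabs_mult, Rabs_pos_eq by exact Hr.
      apply Rmult_le_compat_l; auto. }
    apply subdiff_at_zero in K; [|exact H0]. destruct K as [_ K].
    specialize (K u). now rewrite Hn in K.
  - right. apply NNPP. intros HN.
    destruct (convex_sandwich (fun v => f (vplus X xb v)) r) as (psi & Hd & Hb & Hle); auto.
    + intros x y a b t Hx Hy Ht. specialize (Hc _ _ _ _ _ Hx Hy Ht).
      replace (vplus X xb (vplus X (vscal X t x) (vscal X (1 - t) y)))
        with (vplus X (vscal X t (vplus X xb x)) (vscal X (1 - t) (vplus X xb y))) by vec.
      exact Hc.
    + now rewrite vplus_zero.
    + intros v. apply NNPP. intros K. apply HN. exists (vplus X xb v).
      specialize (Hp (vplus X xb v)).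
      destruct (f (vplus X xb v)) as [a| |]; simpl in K; try tauto.
      exists a. split; [reflexivity|].
      replace (vminus (vplus X xb v) xb) with v by vec. lra.
    + apply HS. apply (bd_slope_ball f xb r psi); auto.
      apply subdiff_at_zero; [exact H0|]. split; [exact Hd|].
      intros u. specialize (Hle (vminus u xb)).
      now replace (vplus X xb (vminus u xb)) with u in Hle by vec.
Qed.

(** * Error bound moduli *)

Lemma dist_finite (S : X -> Prop) x y :
  S y -> exists d, Defs.dist x S = Fin d /\ 0 <= d <= nrm (vminus y x).
Proof.
  intros Hy.
  assert (H1 : ERle (Defs.dist x S) (Fin (nrm (vminus y x)))).
  { eapply ERinf_le; [now exists y|]. apply ERle_refl. }
  assert (H0 : ERle (Fin 0) (Defs.dist x S)).
  { apply ERinf_ge. intros z (u & _ & ->). apply vnorm_nonneg. }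
  destruct (Defs.dist x S) as [d| |]; try easy. exists d. auto.
Qed.

(** Any level-set point [y] bounds the distance from above and so the quotient from below, uniformly
    on a ball around [xb]. *)
Lemma Er_ge (g : X -> ERbar) xb c delta : proper g -> g xb = Fin 0 -> 0 <= c -> 0 < delta ->
  (forall x a, nrm (vminus x xb) < delta -> g x = Fin a -> 0 < a ->
     exists y, Slev g y /\ c * nrm (vminus y x) <= a) ->
  ERle (Fin c) (Er g xb).
Proof.
  intros [Hp _] H0 Hc Hdelta H.
  eapply ERle_trans; [|apply (proj1 (ERsup_lub _)); exists delta; split; [exact Hdelta|reflexivity]].
  apply ERinf_ge. intros w (x & Hx & Hpos & ->).
  assert (Hxb : Slev g xb) by (unfold Slev; rewrite H0; simpl; lra).
  apply ERlt_not_le in Hpos. specialize (Hp x).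
  destruct (g x) as [a| |] eqn:Ea; [| |easy].
  - simpl in Hpos. apply Rnot_le_lt in Hpos.
    destruct (H x a Hx Ea Hpos) as (y & Hy & Hle).
    destruct (dist_finite (Slev g) x y Hy) as (d & -> & Hd). simpl.
    (* At distance zero [ratio] is [PInf], so the bound is immediate. *)
    destruct (Rlt_dec 0 d) as [Pd|_]; simpl; [|exact I].
    apply Rmult_le_reg_r with d; [exact Pd|].
    replace (a / d * d) with a by (field; lra). nra.
  - destruct (dist_finite (Slev g) x xb Hxb) as (d & -> & Hd). exact I.
Qed.

Lemma Er_nonneg (g : X -> ERbar) xb : proper g -> g xb = Fin 0 -> ERle (Fin 0) (Er g xb).
Proof.
  intros Hg H0. apply Er_ge with 1; auto; try lra.
  intros x a _ _ Ha. exists xb. split; [|lra].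
  unfold Slev. rewrite H0. simpl. lra.
Qed.

(* Slater's condition: from [x] one reaches the level set on the way to [u]. *)
Lemma Er_ge_slater (g : X -> ERbar) xb u a c :
  Gamma0 g -> g xb = Fin 0 -> 0 <= c -> g u = Fin a -> a < - c * nrm (vminus u xb) ->
  ERle (Fin c) (Er g xb).
Proof.
  intros (Hp & Hc & _) H0 Hc0 Ha Hac.
  pose proof (vnorm_nonneg X (vminus u xb)) as Hn. fold (nrm (vminus u xb)) in Hn.
  (* The radius ensures [c * nrm (vminus u x) <= - a] for every [x] in the ball; [c + 1] in the
     denominator allows [c = 0]. *)
  assert (Hdelta : 0 < (- a - c * nrm (vminus u xb)) / (c + 1)) by (apply Rdiv_lt_0_compat; lra).
  apply Er_ge with ((- a - c * nrm (vminus u xb)) / (c + 1)); auto.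
  intros x b Hx Hb Hbpos.
  assert (Ha0 : a < 0) by nra.
  (* This is the zero of the affine interpolation from [b] at [x] to [a] at [u]. *)
  assert (Ht : 0 <= b / (b - a) <= 1).
  { split; [apply Rlt_le, Rdiv_lt_0_compat; lra|].
    apply Rmult_le_reg_r with (b - a); [lra|].
    replace (b / (b - a) * (b - a)) with b by (field; lra). lra. }
  exists (vplus X (vscal X (b / (b - a)) u) (vscal X (1 - b / (b - a)) x)). split.
  - pose proof (Hc u x a b (b / (b - a)) Ha Hb Ht) as K.
    replace (b / (b - a) * a + (1 - b / (b - a)) * b) with 0 in K by (field; lra).
    exact K.
  - replace (vminus _ x) with (vscal X (b / (b - a)) (vminus u x)) by vec.
    rewrite nrm_scal_pos by lra.
    pose proof (nrm_triangle_minus u xb x) as T. rewrite (nrm_minus_sym xb x) in T.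
    assert (C : c * nrm (vminus x xb) <= - a - c * nrm (vminus u xb)).
    { apply Rle_trans with ((c + 1) * ((- a - c * nrm (vminus u xb)) / (c + 1))).
      - pose proof (vnorm_nonneg X (vminus x xb)) as N. fold (nrm (vminus x xb)) in N. nra.
      - right. field. lra. }
    assert (C2 : c * nrm (vminus u x) <= b - a) by nra.
    replace b with (b / (b - a) * (b - a)) at 3 by (field; lra). nra.
Qed.

(** * Stability of the modulus under perturbations *)

Lemma exists_small_scaling n delta : 0 <= n -> 0 < delta -> exists t, 0 < t <= 1 /\ t * n < delta.
Proof.
  intros Hn Hd. exists (Rmin 1 (delta / (n + 1))).
  assert (P : 0 < delta / (n + 1)) by (apply Rdiv_lt_0_compat; lra).
  split; [split; [apply Rmin_glb_lt; lra | apply Rmin_l]|].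
  apply Rle_lt_trans with (delta / (n + 1) * n).
  - apply Rmult_le_compat_r; [exact Hn | apply Rmin_r].
  - replace delta with (delta / (n + 1) * (n + 1)) at 2 by (field; lra). nra.
Qed.

Lemma convex_toward_zero (f : X -> ERbar) xb u a t :
  Gamma0 f -> f xb = Fin 0 -> f u = Fin a -> 0 < t <= 1 ->
  exists b, f (vplus X (vscal X t u) (vscal X (1 - t) xb)) = Fin b /\ b <= t * a.
Proof.
  intros ([Hp _] & Hc & _) H0 Ha Ht.
  assert (Ht' : 0 <= t <= 1) by lra.
  pose proof (Hc _ _ _ _ _ Ha H0 Ht') as K.
  specialize (Hp (vplus X (vscal X t u) (vscal X (1 - t) xb))).
  destruct (f _) as [b| |]; simpl in K; try easy.
  exists b. split; [reflexivity|lra].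
Qed.

Lemma Er_perturbation_ge (f g : X -> ERbar) xb eps r :
  Gamma0 f -> f xb = Fin 0 -> 0 < eps < r -> ERlt (Fin r) (bd_slope f xb) ->
  Gamma0 g -> Ptb f xb eps g -> ERle (Fin ((r - eps) / 2)) (Er g xb).
Proof.
  intros Hf H0 He Hs Hg [Hgxb Hptb]. rewrite H0 in Hgxb.
  (* Half of the gap [r - eps] pays for [eta]; the other half remains as the bound. *)
  destruct (Hptb ((r - eps) / 2)) as (delta & Hdelta & Hclose); [lra|].
  destruct (bd_slope_dichotomy f xb r) as [Hgrow|(u & a & Hu & Hau)]; auto; try lra.
  - apply Er_ge with delta; auto; [apply Hg|lra|].
    intros x a Hx Ha _. exists xb. split; [unfold Slev; rewrite Hgxb; simpl; lra|].
    specialize (Hclose x Hx). specialize (Hgrow x). rewrite Ha in Hclose.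
    destruct (f x) as [b| |]; simpl in *; try easy.
    rewrite (nrm_minus_sym xb x).
    pose proof (Rle_abs (- (a - b))) as K. rewrite Rabs_Ropp in K. lra.
  - destruct (exists_small_scaling (nrm (vminus u xb)) delta) as (t & Ht & Htd);
      [apply vnorm_nonneg|exact Hdelta|].
    destruct (convex_toward_zero f xb u a t) as (b & Hb & Hbt); auto.
    set (ut := vplus X (vscal X t u) (vscal X (1 - t) xb)) in *.
    assert (En : nrm (vminus ut xb) = t * nrm (vminus u xb)).
    { rewrite <- nrm_scal_pos by lra. f_equal. unfold ut. vec. }
    specialize (Hclose ut). rewrite Hb, En in Hclose. specialize (Hclose Htd).
    destruct (g ut) as [a'| |] eqn:Ea'; simpl in Hclose; try easy.
    apply (Er_ge_slater g xb ut a'); auto; [lra|]. rewrite En.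
    pose proof (Rle_abs (a' - b)) as K.
    assert (t * a < t * (- r * nrm (vminus u xb))) by (apply Rmult_lt_compat_l; lra).
    lra.
Qed.

Lemma bd_slope_le_radius (f : X -> ERbar) xb :
  Gamma0 f -> f xb = Fin 0 -> ERle (bd_slope f xb) (radius (ErPtb f xb)).
Proof.
  intros Hf H0. apply ERinf_ge. intros y (eps & He & HQ & ->).
  apply NNPP. intros HN.
  assert (Hr : exists r, eps < r /\ ERlt (Fin r) (bd_slope f xb)).
  { destruct (bd_slope f xb) as [s| |]; simpl in HN; [| |tauto].
    - exists ((eps + s) / 2). split; [lra|]. apply ERlt_not_le. simpl. lra.
    - exists (eps + 1). split; [lra|]. apply ERlt_not_le. simpl. tauto. }
  destruct Hr as (r & Her & Hr).
  assert (K : ERle (Fin ((r - eps) / 2)) (ErPtb f xb eps)).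
  { apply ERinf_ge. intros z (g & Hg & Hptb & ->). now apply (Er_perturbation_ge f g xb eps r). }
  rewrite HQ in K. simpl in K. lra.
Qed.

(* If [0] lies on the boundary of the subdifferential of the nonnegative function [f - phi],
   then adding [delta] times a functional norming a direction of slow growth makes the error
   bound modulus at most [2 delta]. *)
Lemma small_Er_linear_perturbation (f : X -> ERbar) xb phi rho delta :
  Gamma0 f -> f xb = Fin 0 -> bd (subdiff f xb) phi -> dnorm phi = Fin rho -> 0 < delta ->
  exists g, Ptb_l f xb (rho + delta) g /\ ERle (Er g xb) (Fin (2 * delta)).
Proof.
  intros Hf H0 [Hd Hbd] Hrho Hdelta.
  assert (Hphi : forall x, Rabs (phi x) <= rho * nrm x).
  { apply dnorm_bound; [exact Hd|]. rewrite Hrho. apply ERle_refl. }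
  assert (Hrho0 : 0 <= rho).
  { destruct (dnorm_finite phi Hd) as (r & Hr & E). rewrite Hrho in E. injection E as ->. exact Hr. }
  (* The boundary point [phi] is itself a subgradient: a violation at [u] would persist for all
     functionals close enough to [phi]. *)
  assert (Hsub : forall u a, f u = Fin a -> phi (vminus u xb) <= a).
  { intros u a Ha. apply Rnot_lt_le. intros K.
    assert (Pr : 0 < (phi (vminus u xb) - a) / (nrm (vminus u xb) + 1)).
    { pose proof (vnorm_nonneg X (vminus u xb)). unfold nrm. apply Rdiv_lt_0_compat; lra. }
    destruct (Hbd _ Pr) as [(psi & Hpd & Hps & Hpn) _].
    apply subdiff_at_zero in Hps; [|exact H0]. destruct Hps as [_ Hps].
    specialize (Hps u). rewrite Ha in Hps. simpl in Hps.
    pose proof (dnorm_bound _ _ (dual_dminus _ _ Hpd Hd) (proj1 Hpn) (vminus u xb)) as B. unfold dminus in B.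
    pose proof (Rle_abs (- (psi (vminus u xb) - phi (vminus u xb)))) as B2.
    rewrite Rabs_Ropp in B2.
    assert (B3 : (phi (vminus u xb) - a) / (nrm (vminus u xb) + 1) * nrm (vminus u xb)
                 < phi (vminus u xb) - a).
    { pose proof (vnorm_nonneg X (vminus u xb)) as N. fold (nrm (vminus u xb)) in N.
      replace (phi (vminus u xb) - a) with
        ((phi (vminus u xb) - a) / (nrm (vminus u xb) + 1) * (nrm (vminus u xb) + 1)) at 2
        by (field; lra). nra. }
    lra. }
  (* A functional outside the subdifferential within [delta] of [phi] exceeds [f] somewhere; passing
     back to [phi] costs at most [delta * nrm (vminus u xb)]. *)
  assert (Hslow : exists u a, f u = Fin a /\
            a < phi (vminus u xb) + delta * nrm (vminus u xb)).
  { destruct (Hbd _ Hdelta) as [_ (psi & Hpd & Hps & Hpn)].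
    apply NNPP. intros HN. apply Hps. apply subdiff_at_zero; [exact H0|].
    split; [exact Hpd|]. intros u. destruct Hf as ([Hp _] & _). specialize (Hp u).
    destruct (f u) as [a| |] eqn:Ea; simpl; try easy.
    apply Rnot_lt_le. intros K. apply HN. exists u, a. split; [exact Ea|].
    pose proof (dnorm_bound _ _ (dual_dminus _ _ Hpd Hd) (proj1 Hpn) (vminus u xb)) as B. unfold dminus in B.
    pose proof (Rle_abs (psi (vminus u xb) - phi (vminus u xb))). lra. }
  destruct Hslow as (u & a & Hu & Hau).
  pose proof (Hsub u a Hu) as Hau'.
  assert (Hn : 0 < nrm (vminus u xb)).
  { destruct (vnorm_nonneg X (vminus u xb)) as [N|N]; [exact N|].
    fold (nrm (vminus u xb)) in N. rewrite <- N in Hau. lra. }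
  destruct (norming_functional (vminus u xb)) as (nu & Hnd & Hnu & Hnb).
  set (chi := fun x => (-1) * phi x + delta * nu x).
  assert (Hchi : is_dual chi) by now apply dual_comb.
  set (g := fun v => ERplus (f v) (Fin (chi (vminus v xb)))).
  exists g. split.
  { exists chi. split; [exact Hchi|split; [|reflexivity]].
    apply dnorm_le; [lra|]. intros x. unfold chi.
    eapply Rle_trans; [apply Rabs_triang|].
    rewrite !Rabs_mult, (Rabs_left (-1)), (Rabs_pos_eq delta) by lra.
    specialize (Hphi x). specialize (Hnb x). nra. }
  assert (Hxb : Slev g xb).
  { unfold Slev, g. rewrite H0. simpl.
    replace (vminus xb xb) with (vzero X) by vec. rewrite dual_zero by exact Hchi. lra. }
  apply ERsup_lub. intros s (Delta & HDelta & ->).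
  destruct (exists_small_scaling (nrm (vminus u xb)) Delta) as (t & Ht & Htd); [lra|exact HDelta|].
  destruct (convex_toward_zero f xb u a t) as (b & Hb & Hbt); auto.
  pose proof (Hsub _ _ Hb) as Hbphi.
  set (ut := vplus X (vscal X t u) (vscal X (1 - t) xb)) in *.
  assert (Eu : vminus ut xb = vscal X t (vminus u xb)) by (unfold ut; vec).
  assert (En : nrm (vminus ut xb) = t * nrm (vminus u xb)) by (rewrite Eu, nrm_scal_pos; lra).
  assert (Ephi : phi (vminus ut xb) = t * phi (vminus u xb)) by (rewrite Eu; apply Hd).
  assert (Enu : nu (vminus ut xb) = t * nrm (vminus u xb))
    by (rewrite Eu, <- Hnu; apply Hnd).
  assert (Hgu : g ut = Fin (b - t * phi (vminus u xb) + delta * (t * nrm (vminus u xb)))).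
  { unfold g, chi. rewrite Hb, Ephi, Enu. simpl. f_equal. ring. }
  assert (Htn : 0 < t * nrm (vminus u xb)) by (apply Rmult_lt_0_compat; lra).
  (* Since [f] dominates [phi], the level set of [g] lies where [nu (v - xb) <= 0], and [nu] has
     norm at most one. *)
  assert (Hdist : ERle (Fin (t * nrm (vminus u xb))) (Defs.dist ut (Slev g))).
  { apply ERinf_ge. intros y (v & Hv & ->). simpl.
    unfold Slev, g in Hv. destruct Hf as ([Hp _] & _). specialize (Hp v).
    destruct (f v) as [e| |] eqn:Ee; simpl in Hv; try easy.
    pose proof (Hsub v e Ee) as He. unfold chi in Hv.
    assert (Hnv : nu (vminus v xb) <= 0).
    { apply Rmult_le_reg_l with delta; [exact Hdelta|]. lra. }
    apply Rle_trans with (nu (vminus ut v)).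
    - rewrite (dual_minus nu ut xb Hnd) in Enu. rewrite (dual_minus nu v xb Hnd) in Hnv.
      rewrite (dual_minus nu ut v Hnd). lra.
    - rewrite (nrm_minus_sym v ut). eapply Rle_trans; [apply Rle_abs|apply Hnb]. }
  eapply ERinf_le.
  { exists ut. split; [rewrite En; exact Htd|]. split; [|reflexivity].
    rewrite Hgu. apply ERlt_not_le. simpl. nra. }
  rewrite Hgu.
  destruct (dist_finite (Slev g) ut xb Hxb) as (d & Ed & _).
  rewrite Ed in *. simpl in Hdist. simpl.
  destruct (Rlt_dec 0 d) as [Pd|Pd]; [|lra].
  simpl. apply Rmult_le_reg_r with d; [exact Pd|].
  replace (_ / d * d) with (b - t * phi (vminus u xb) + delta * (t * nrm (vminus u xb)))
    by (field; lra).
  (* The value at [ut] is at most [2 * delta * t * nrm (vminus u xb)], and [d] is at least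
     [t * nrm (vminus u xb)]. *)
  assert (t * a <= t * (phi (vminus u xb) + delta * nrm (vminus u xb)))
    by (apply Rmult_le_compat_l; lra).
  nra.
Qed.

(** * Comparison of the perturbation classes *)

Lemma Gamma0_affine phi xb : is_dual phi -> Gamma0 (fun u => Fin (phi (vminus u xb))).
Proof.
  intros Hd. split; [|split].
  - split; [discriminate|]. exists xb. discriminate.
  - intros x y a b t [= <-] [= <-] _. simpl. rewrite !dual_minus by exact Hd.
    destruct Hd as (Ha & Hs & _). rewrite Ha, !Hs. lra.
  - intros x r Hr. apply ERlt_not_le in Hr. simpl in Hr.
    destruct (dnorm_finite phi Hd) as (M & HM & EM).
    assert (B : forall x, Rabs (phi x) <= M * nrm x).
    { apply dnorm_bound; [exact Hd|]. rewrite EM. apply ERle_refl. }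
    assert (P : 0 < (phi (vminus x xb) - r) / (M + 1)) by (apply Rdiv_lt_0_compat; lra).
    exists ((phi (vminus x xb) - r) / (M + 1)). split; [exact P|].
    intros u Hu. apply ERlt_not_le. simpl.
    specialize (B (vminus u x)).
    pose proof (Rle_abs (- phi (vminus u x))) as B2. rewrite Rabs_Ropp in B2.
    assert (B3 : M * nrm (vminus u x) < phi (vminus x xb) - r).
    { replace (phi (vminus x xb) - r) with ((M + 1) * ((phi (vminus x xb) - r) / (M + 1)))
        by (field; lra).
      pose proof (vnorm_nonneg X (vminus u x)). unfold nrm in *. nra. }
    pose proof (dual_minus phi u x Hd). pose proof (dual_minus phi x xb Hd).
    pose proof (dual_minus phi u xb Hd). lra.
Qed.

Lemma Gamma0_plus (f h : X -> ERbar) xb c :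
  Gamma0 f -> Gamma0 h -> ERplus (f xb) (h xb) = Fin c ->
  Gamma0 (fun u => ERplus (f u) (h u)).
Proof.
  intros ([Pf _] & Cf & Lf) ([Ph _] & Ch & Lh) Hxb. split; [split|split].
  - intros x. specialize (Pf x). specialize (Ph x). now destruct (f x), (h x).
  - exists xb. now rewrite Hxb.
  - intros x y a b t Hx Hy Ht.
    destruct (f x) as [fx| |] eqn:Efx, (h x) as [hx| |] eqn:Ehx; try discriminate Hx.
    destruct (f y) as [fy| |] eqn:Efy, (h y) as [hy| |] eqn:Ehy; try discriminate Hy.
    injection Hx as <-. injection Hy as <-.
    pose proof (Cf _ _ _ _ _ Efx Efy Ht) as K1.
    pose proof (Ch _ _ _ _ _ Ehx Ehy Ht) as K2.
    destruct (f (vplus X (vscal X t x) (vscal X (1 - t) y))),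
             (h (vplus X (vscal X t x) (vscal X (1 - t) y))); simpl in *; try easy. lra.
  - intros x r Hr.
    (* The level [r] is split between the summands: finite values share the excess equally, and an
       infinite value absorbs what the finite one leaves. *)
    assert (Hsplit : exists r1 r2, r <= r1 + r2 /\ ERlt (Fin r1) (f x) /\ ERlt (Fin r2) (h x)).
    { apply ERlt_not_le in Hr. specialize (Pf x). specialize (Ph x).
      destruct (f x) as [a| |], (h x) as [b| |]; simpl in Hr; try easy.
      - exists (a - (a + b - r) / 2), (b - (a + b - r) / 2).
        split; [lra|]. rewrite !ERlt_not_le. simpl. lra.
      - exists (a - 1), (r - a + 1). split; [lra|]. rewrite !ERlt_not_le. simpl. split; [lra|tauto].
      - exists (r - b + 1), (b - 1). split; [lra|]. rewrite !ERlt_not_le. simpl. split; [tauto|lra].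
      - exists r, 0. split; [lra|]. rewrite !ERlt_not_le. simpl. tauto. }
    destruct Hsplit as (r1 & r2 & Hr12 & H1 & H2).
    destruct (Lf _ _ H1) as (d1 & Hd1 & K1). destruct (Lh _ _ H2) as (d2 & Hd2 & K2).
    exists (Rmin d1 d2). split; [now apply Rmin_glb_lt|]. intros u Hu.
    specialize (K1 u (Rlt_le_trans _ _ _ Hu (Rmin_l _ _))).
    specialize (K2 u (Rlt_le_trans _ _ _ Hu (Rmin_r _ _))).
    rewrite ERlt_not_le in *.
    destruct (f u), (h u); simpl in *; try tauto; lra.
Qed.

Lemma Ptb_l_Ptb_c (f g : X -> ERbar) xb eps :
  Gamma0 f -> f xb = Fin 0 -> Ptb_l f xb eps g -> Ptb_c f xb eps g.
Proof.
  intros ([Hp _] & _) H0 (phi & Hd & Hn & Hg). split.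
  - split.
    + rewrite Hg, H0. simpl. replace (vminus xb xb) with (vzero X) by vec.
      rewrite dual_zero by exact Hd. f_equal. ring.
    + intros eta Heta. exists 1. split; [lra|]. intros x _.
      rewrite Hg. specialize (Hp x). destruct (f x) as [a| |]; simpl; try easy.
      pose proof (dnorm_bound _ _ Hd Hn (vminus x xb)) as B.
      replace (a + phi (vminus x xb) - a) with (phi (vminus x xb)) by ring.
      pose proof (vnorm_nonneg X (vminus x xb)). unfold nrm in *. nra.
  - eexists. split; [exact (Gamma0_affine phi xb Hd)|exact Hg].
Qed.

Lemma Ptb_c_Gamma0 (f g : X -> ERbar) xb eps :
  Gamma0 f -> f xb = Fin 0 -> Ptb_c f xb eps g -> Gamma0 g.
Proof.
  intros Hf H0 ([Hxb _] & h & Hh & Hg).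
  replace g with (fun u => ERplus (f u) (h u)) by (extensionality u; now rewrite Hg).
  apply Gamma0_plus with xb 0; auto. now rewrite <- Hg, Hxb.
Qed.

Lemma ErPtb_nonneg (f : X -> ERbar) xb eps : f xb = Fin 0 -> ERle (Fin 0) (ErPtb f xb eps).
Proof.
  intros H0. apply ERinf_ge. intros y (g & Hg & [Hxb _] & ->).
  apply Er_nonneg; [apply Hg|]. now rewrite Hxb.
Qed.

Lemma ErPtb_le_ErPtb_c (f : X -> ERbar) xb eps : Gamma0 f -> f xb = Fin 0 ->
  ERle (ErPtb f xb eps) (ErPtb_c f xb eps).
Proof.
  intros Hf H0. apply ERinf_antimono. intros y (g & Hg & ->).
  exists g. split; [eapply Ptb_c_Gamma0; eauto|]. split; [apply Hg|reflexivity].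
Qed.

Lemma ErPtb_c_le_ErPtb_l (f : X -> ERbar) xb eps : Gamma0 f -> f xb = Fin 0 ->
  ERle (ErPtb_c f xb eps) (ErPtb_l f xb eps).
Proof.
  intros Hf H0. apply ERinf_antimono. intros y (g & Hg & ->).
  exists g. split; [now apply Ptb_l_Ptb_c|reflexivity].
Qed.

(** Nonnegativity turns a zero of [Q] into a zero of [P], so the infimum for [P] runs over a larger
    set. *)
Lemma radius_mono (P Q : R -> ERbar) :
  (forall eps, ERle (Fin 0) (P eps)) -> (forall eps, ERle (P eps) (Q eps)) ->
  ERle (radius P) (radius Q).
Proof.
  intros H0 HPQ. apply ERinf_antimono. intros y (eps & He & HQ & ->).
  exists eps. repeat split; auto. apply ERle_antisym; [|apply H0].
  rewrite <- HQ. apply HPQ.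
Qed.

Lemma radius_l_le_bd_slope (f : X -> ERbar) xb :
  Gamma0 f -> f xb = Fin 0 -> ERle (radius (ErPtb_l f xb)) (bd_slope f xb).
Proof.
  intros Hf H0. apply ERinf_ge. intros y (phi & Hbd & ->).
  destruct (dnorm_finite phi (proj1 Hbd)) as (rho & Hrho & E). rewrite E.
  apply ERle_Fin_approx. intros d Hd.
  apply ERinf_le with (Fin (rho + d)); [|apply ERle_refl].
  exists (rho + d). split; [lra|]. split; [|reflexivity].
  apply ERle_antisym.
  - apply ERle_Fin_approx. intros e He. rewrite Rplus_0_l.
    (* The bound [d] keeps the perturbation in the class of size [rho + d], and [e / 2] makes the
       modulus at most [e]. *)
    set (delta := Rmin d (e / 2)).
    assert (Hdelta : 0 < delta) by (apply Rmin_glb_lt; lra).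
    destruct (small_Er_linear_perturbation f xb phi rho delta)
      as (g & (chi & Hchi & Hn & Hg) & HEr); auto.
    apply ERinf_le with (Er g xb).
    + exists g. split; [|reflexivity]. exists chi. split; [exact Hchi|]. split; [|exact Hg].
      eapply ERle_trans; [exact Hn|]. simpl. pose proof (Rmin_l d (e / 2)). unfold delta. lra.
    + eapply ERle_trans; [exact HEr|]. simpl. pose proof (Rmin_r d (e / 2)). unfold delta. lra.
  - eapply ERle_trans; [now apply (ErPtb_nonneg f xb (rho + d))|].
    eapply ERle_trans; [apply ErPtb_le_ErPtb_c|apply ErPtb_c_le_ErPtb_l]; auto.
Qed.

End Dual.

Theorem mainTheorem2 (X : BanachSpace) (f : X -> ERbar) (xb : X) :
  Gamma0 f -> f xb = Fin 0 ->
  bd_slope f xb = radius (ErPtb f xb) /\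
  bd_slope f xb = radius (ErPtb_c f xb) /\
  bd_slope f xb = radius (ErPtb_l f xb).
Proof.
  intros Hf H0.
  pose proof (bd_slope_le_radius f xb Hf H0) as H1.
  pose proof (radius_l_le_bd_slope f xb Hf H0) as H4.
  assert (H2 : ERle (radius (ErPtb f xb)) (radius (ErPtb_c f xb))).
  { apply radius_mono; intros eps; [now apply ErPtb_nonneg|now apply ErPtb_le_ErPtb_c]. }
  assert (H3 : ERle (radius (ErPtb_c f xb)) (radius (ErPtb_l f xb))).
  { apply radius_mono; intros eps; [|now apply ErPtb_c_le_ErPtb_l].
    apply ERle_trans with (ErPtb f xb eps); [now apply ErPtb_nonneg|now apply ErPtb_le_ErPtb_c]. }
  split; [|split]; apply ERle_antisym; eauto using ERle_trans.
Qed.
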